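(* Let $k\ge3$ and $1\le n\le2k-2$ be integers. Every variety in the interval $$[\mathsf V(S_c^*(a_1\cdots a_k)),\ \mathsf V(S_c^*(a^n))\vee\mathsf V(S_c^*(a_1\cdots a_k))]$$ is nonfinitely based.
   Context: An ai-semiring (additively idempotent semiring) is an algebra $(S,+,\cdot)$ with two binary operations such that $(S,+)$ is a commutative idempotent semigroup, $(S,\cdot)$ is a semigroup, and both distributive laws hold. The signature is $(+,\cdot)$, with no constants. $\mathsf V(S)$ denotes the variety generated by $S$, and $\vee$ is the join in the lattice of varieties. For varieties $\mathcal A\subseteq\mathcal B$, the interval $[\mathcal A,\mathcal B]$ consists of all varieties $\mathcal W$ with $\mathcal A\subseteq\mathcal W\subseteq\mathcal B$. A variety is finitely based if its identities all follow from a finite set of them; otherwise it is nonfinitely based. For $n\ge 1$, $S_c^*(a^n)$ is the ai-semiring with universe $\{a,a^2,\ldots,a^n,0\}$ ($n+1$ distinct elements), where $0$ is absorbing for both addition and multiplication, $a^i+a^j=a^{\max\{i,j\}}$, and $a^i a^j=a^{i+j}$ if $i+j\le n$, $a^ia^j=0$ if $i+j>n$. For $k\ge1$ and distinct letters $a_1,\dots,a_k$, the semiring $S_c^*(a_1\cdots a_k)$ has as its nonzero elements all nonempty square-free commutative words on $\{a_1,\ldots,a_k\}$, together with an element $0$ absorbing for both addition and multiplication. For nonzero $u,v$: $u+v$ is the square-free word whose set of letters is the union of the sets of letters of $u$ and $v$; $u\cdot v$ is the square-free word $uv$ if $u$ and $v$ have no letter in common, and $u\cdot v=0$ otherwise.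 *)

(* Defs.v *)
From mathcomp Require Import all_boot zify.

Set Implicit Arguments.
Unset Strict Implicit.
Unset Printing Implicit Defensive.

Record algebra := Algebra {
  carrier :> Type;
  add : carrier -> carrier -> carrier;
  mul : carrier -> carrier -> carrier }.

Record ai_semiring (A : algebra) : Prop := AiSemiring {
  ai_inhabited : inhabited A;
  ai_addA : associative (@add A);
  ai_addC : commutative (@add A);
  ai_addI : idempotent_op (@add A);
  ai_mulA : associative (@mul A);
  ai_mulDl : left_distributive (@mul A) (@add A);
  ai_mulDr : right_distributive (@mul A) (@add A) }.

Definition hom (A B : algebra) (f : A -> B) : Prop :=
  {morph f : x y / add x y} /\ {morph f : x y / mul x y}.

Definition surjective (A B : Type) (f : A -> B) : Prop :=
  forall y, exists x, f x = y.

Definition product (I : Type) (F : I -> algebra) : algebra :=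
  @Algebra (forall i, F i) (fun x y i => add (x i) (y i))
                           (fun x y i => mul (x i) (y i)).

Definition subclass (V W : algebra -> Prop) : Prop := forall A, V A -> W A.

(* Subalgebras are taken up to isomorphism, as (nonempty) domains of embeddings. *)
Record variety (W : algebra -> Prop) : Prop := Variety {
  variety_ai : subclass W ai_semiring;
  variety_H : forall (A B : algebra) (f : A -> B),
    hom f -> surjective f -> W A -> W B;
  variety_S : forall (A B : algebra) (f : A -> B),
    inhabited A -> hom f -> injective f -> W B -> W A;
  variety_P : forall (I : Type) (F : I -> algebra),
    (forall i, W (F i)) -> W (product F) }.

Definition var_gen (S : algebra) : algebra -> Prop :=
  fun A => forall W, variety W -> W S -> W A.

Definition var_join (V1 V2 : algebra -> Prop) : algebra -> Prop :=
  fun A => forall W, variety W -> subclass V1 W -> subclass V2 W -> W A.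

Definition var_interval (V1 V2 W : algebra -> Prop) : Prop :=
  [/\ variety W, subclass V1 W & subclass W V2].

Inductive term :=
  | Var of nat
  | Add of term & term
  | Mul of term & term.

Fixpoint eval (A : algebra) (v : nat -> A) (t : term) : A :=
  match t with
  | Var i => v i
  | Add t1 t2 => add (eval v t1) (eval v t2)
  | Mul t1 t2 => mul (eval v t1) (eval v t2)
  end.

Definition identity := (term * term)%type.

Definition satisfies (A : algebra) (e : identity) : Prop :=
  forall v : nat -> A, eval v e.1 = eval v e.2.

Definition identity_of (W : algebra -> Prop) (e : identity) : Prop :=
  forall A, W A -> satisfies A e.

(* Consequence is taken over all algebras with two binary operations, so the
   finite set has to entail the ai-semiring axioms as well; as there are
   finitely many of these, working relative to ai-semirings is equivalent. *)
Definition follows_from (m : nat) (s : 'I_m -> identity) (e : identity) : Prop :=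
  forall A : algebra, (forall i, satisfies A (s i)) -> satisfies A e.

Definition finitely_based (W : algebra -> Prop) : Prop :=
  exists (m : nat) (s : 'I_m -> identity),
    (forall i, identity_of W (s i)) /\
    (forall e, identity_of W e -> follows_from s e).

(* S_c^*(a^n): Some i is a^(i+1), for i < n, and None is 0; insub j is Some j if
   j < n and None otherwise. *)
Definition pow_add n (x y : option 'I_n) : option 'I_n :=
  match x, y with
  | Some i, Some j => Some (if i <= j then j else i)
  | _, _ => None
  end.

Definition pow_mul n (x y : option 'I_n) : option 'I_n :=
  match x, y with
  | Some i, Some j => insub (i + j).+1
  | _, _ => None
  end.

Definition Sc_pow (n : nat) : algebra :=
  @Algebra (option 'I_n) (@pow_add n) (@pow_mul n).

(* S_c^*(a_1...a_k): a nonempty square-free commutative word is identified with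
   its nonempty set of letters, and None is 0. *)
Definition sqfree_word (k : nat) := {u : {set 'I_k} | u != set0}.

Lemma wordU_subproof k (u v : sqfree_word k) : val u :|: val v != set0.
Proof. by rewrite setU_eq0 negb_and (valP u). Qed.

Definition wordU k (u v : sqfree_word k) : sqfree_word k :=
  exist _ (val u :|: val v) (wordU_subproof u v).

Definition word_add k (x y : option (sqfree_word k)) : option (sqfree_word k) :=
  match x, y with
  | Some u, Some v => Some (wordU u v)
  | _, _ => None
  end.

Definition word_mul k (x y : option (sqfree_word k)) : option (sqfree_word k) :=
  match x, y with
  | Some u, Some v => if [disjoint val u & val v] then Some (wordU u v) else None
  | _, _ => None
  end.

Definition Sc_word (k : nat) : algebra :=
  @Algebra (option (sqfree_word k)) (@word_add k) (@word_mul k).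

Lemma Sc_pow_ai n : 0 < n -> ai_semiring (Sc_pow n).
Proof.
move=> n_gt0; pose phi := oapp (@nat_of_ord n) n.
have phi_inj : injective phi.
  case=> [i|] [j|] //=; [by move/val_inj->| |].
  - by move=> eq_in; have := ltn_ord i; rewrite eq_in ltnn.
  - by move=> eq_nj; have := ltn_ord j; rewrite -eq_nj ltnn.
have phi_le x : phi x <= n by case: x => [i|] //=; apply: ltnW.
have phi_add x y : phi (pow_add x y) = maxn (phi x) (phi y).
  case: x y => [i|] [j|] //=.
  - by case: leqP => // _.
  - by rewrite (maxn_idPr (ltnW _)).
  - by rewrite (maxn_idPl (ltnW _)).
  - by rewrite maxnn.
have phi_mul x y : phi (pow_mul x y) = minn n (phi x + phi y).+1.
  case: x y => [i|] [j|] /=.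
  - case: insubP => [l lt_l /= ->|]; first by rewrite (minn_idPr (ltnW _)).
    by rewrite -leqNgt => /minn_idPl->.
  - by rewrite (minn_idPl _) // leqW ?leq_addl.
  - by rewrite (minn_idPl _) // leqW ?leq_addr.
  - by rewrite (minn_idPl _) // leqW ?leq_addr.
split; first (by constructor; exact: None); move=> x.
- by move=> y z; apply: phi_inj; rewrite !phi_add maxnA.
- by move=> y; apply: phi_inj; rewrite !phi_add maxnC.
- by apply: phi_inj; rewrite phi_add maxnn.
all: move=> y z; apply: phi_inj; rewrite !(phi_add, phi_mul); lia.
Qed.

Lemma Sc_word_ai k : ai_semiring (Sc_word k).
Proof.
have word_eq (u v : sqfree_word k) : val u = val v -> Some u = Some v.
  by move/val_inj->.
split; first (by constructor; exact: None).
- by case=> [u|] [v|] [w|] //; apply: word_eq; rewrite /= setUA.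
- by case=> [u|] [v|] //; apply: word_eq; rewrite /= setUC.
- by case=> [u|] //; apply: word_eq; rewrite /= setUid.
all: case=> [[u un0]|] [[v vn0]|] [[w wn0]|] //=; try by case: ifP.
- rewrite -!setI_eq0; case: (eqVneq (u :&: v) set0) => uv;
  case: (eqVneq (v :&: w) set0) => vw //=;
  rewrite -!setI_eq0 /= ?setIUl ?setIUr !setU_eq0 ?uv ?vw ?eqxx /= ?andbT //.
  + by case: ifP => // _; apply: word_eq; rewrite /= setUA.
  + by rewrite (negbTE vw) andbF.
  + by rewrite (negbTE uv).
- rewrite -!setI_eq0 setIUl setU_eq0; case: eqP => //= _; case: eqP => //= _.
  by apply: word_eq; rewrite /= setUACA setUid.
- rewrite -!setI_eq0 setIUr setU_eq0; case: eqP => //= _; case: eqP => //= _.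
  by apply: word_eq; rewrite /= setUACA setUid.
Qed.

(* Main.v *)
(* For a graph (V, e), the nonempty vertex sets together with an absorbing 0,
   where both operations are union except that U1 U2 = 0 unless U1 and U2 are
   completely joined, form a semiring; S_c^*(a_1...a_k) is the case of K_k.  An
   identity of this semiring only depends on its content and on which maps from
   its variables to V send multiplied variables to adjacent vertices, so the
   identities of K_k are about k-colourings.

   Let G be a graph that is not k-colourable, but all of whose small subgraphs
   are bipartite (a shift graph), and let t be the sum of all edges xy of G and
   of a disjoint k-clique z_1...z_k.  The identity t = t + z_1^2 holds in
   S_c^*(a_1...a_k), where both sides are always 0, and in S_c^*(a^n): if all
   words of t have weight at most M <= n <= 2k - 2, then z_1 has weight at most
   M - (k - 1), hence z_1^2 has weight at most 2M - (2k - 2) <= M.  It fails in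
   the semiring of the disjoint union of G and K_k.  But in that graph, any two
   nonadjacent vertices of a small subgraph get the same colour in some
   k-colouring (here k >= 3 leaves two other colours for the bipartite part), and
   so its semiring satisfies all identities of K_k in few variables. *)

Require Import Defs.
From Stdlib Require Import ClassicalEpsilon FunctionalExtensionality.
From mathcomp Require Import all_boot zify.

Set Implicit Arguments.
Unset Strict Implicit.
Unset Printing Implicit Defensive.

(** * Shift graphs *)

Definition ord_lt N : rel 'I_N := fun i j => i < j.

Lemma ord_lt_trans N : transitive (@ord_lt N).
Proof. by move=> j i k; apply: ltn_trans. Qed.

Lemma ord_lt_sorted_uniq N (s : seq 'I_N) : sorted (@ord_lt N) s -> uniq s.
Proof. by apply: sorted_uniq => [|i]; [apply: ord_lt_trans | rewrite /ord_lt ltnn]. Qed.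

(* Colour a sequence s by the set of colours of its one-step extensions. *)
Lemma shift_chromatic r (T : finType) : exists N, forall C : seq 'I_N -> T,
  exists x s y, [/\ size s = r, sorted (@ord_lt N) (x :: rcons s y)
                  & C (x :: s) = C (rcons s y)].
Proof.
elim: r T => [|r IHr] T.
  exists #|T|.+1 => C; pose f i := C [:: i].
  have /injectivePn[x [y neq_xy eq_f]] : ~~ injectiveb f.
    apply/negP => /injectiveP/leq_card.
    by rewrite card_ord ltnn.
  wlog lt_xy : x y neq_xy eq_f / x < y.
    move=> hwlog; case: (ltngtP x y) => [lt_xy|lt_yx|/val_inj eq_xy].
    - exact: hwlog lt_xy.
    - by apply: hwlog lt_yx => //; rewrite eq_sym.
    - by rewrite eq_xy eqxx in neq_xy.
  by exists x, [::], y; split=> //=; rewrite /ord_lt lt_xy.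
have [N hN] := IHr {set T}; exists N => C.
pose ext s := [set C (rcons s z) | z in [pred z | sorted (@ord_lt N) (rcons s z)]].
have [x [s [y [sz_s sorted_s eq_ext]]]] := hN ext.
have : C (x :: rcons s y) \in ext (x :: s).
  by apply/imsetP; exists y; rewrite ?inE.
rewrite eq_ext => /imsetP[z]; rewrite inE => sorted_z eq_C.
exists x, (rcons s y), z; split=> //; first by rewrite size_rcons sz_s.
case: s sorted_s sorted_z {sz_s eq_ext eq_C} => [|w s] /=.
  by rewrite andbT => -> ->.
by case/andP=> ->.
Qed.

Section ShiftGraph.
Variables (m N : nat).
Let V := ((2 * m).+1.-tuple 'I_N)%type.

(** The shift graph on increasing tuples: [v] drops the first entry of [u] and gains a last one,
    while all other tuples are isolated. The odd length provides a middle position [m]. *)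
Definition arrow (u v : V) : bool :=
  [&& sorted (@ord_lt N) u, sorted (@ord_lt N) v & behead u == take (2 * m) v].

Definition shift_edge : rel V := fun u v => arrow u v || arrow v u.

Lemma shift_edge_sym : symmetric shift_edge.
Proof. by move=> u v; rewrite /shift_edge orbC. Qed.

Lemma nth_arrow u v x j : arrow u v -> j < 2 * m -> nth x u j.+1 = nth x v j.
Proof.
by case/and3P=> _ _ /eqP eq_uv lt_j; rewrite -nth_behead eq_uv nth_take.
Qed.

(** Each edge moves a common entry by one position, so an entry that starts in the middle stays
    inside the tuple for [m] steps. *)
Lemma nth_shift_path x u p : path shift_edge u p -> size p <= m -> nth x u m = x ->
  exists j, m <= j + size p /\ j <= m + size p /\ nth x (last u p) j = x.
Proof.
move=> + + nth_u; elim/last_ind: p => [|p w IHp]; first by exists m; rewrite /= !addn0.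
rewrite rcons_path last_rcons size_rcons => /andP[pathp edge_w] le_p.
have [j [j1 [j2 nth_j]]] := IHp pathp (ltnW le_p).
case/orP: edge_w => arr_w.
  exists j.-1; split; [lia|split; [lia|]].
  by rewrite -(nth_arrow _ arr_w) ?prednK //; lia.
exists j.+1; split; [lia|split; [lia|]].
by rewrite (nth_arrow _ arr_w) //; lia.
Qed.

(* All the tuples of a component of S share the middle entry x of a root of
   that component; the parity of the position of x is a 2-colouring. *)
Lemma shift_locally_bipartite (S : {set V}) : #|S| <= m -> exists c : V -> bool,
  forall u v, u \in S -> v \in S -> shift_edge u v -> c u != c v.
Proof.
move=> le_S; pose eS : rel V := fun u v => [&& u \in S, v \in S & shift_edge u v].
have symS : connect_sym eS.
  by apply: sym_connect_sym => u v; rewrite /eS shift_edge_sym andbCA.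
pose mid u := tnth (root eS u) (inord m).
exists (fun u => odd (index (mid u) u)).
have pos_mid u : u \in S -> exists j, [/\ 0 < j, j < 2 * m & nth (mid u) u j = mid u].
  move=> Su; have : connect eS (root eS u) u by rewrite symS connect_root.
  (* Once shortened, the path visits distinct members of [S], so it has fewer than [m] edges and the
     tracked entry reaches neither end of the tuple. *)
  case/connectP=> p0 /shortenP[p pathp uniq_p _] eq_u.
  have Sroot : root eS u \in S.
    by case: p pathp eq_u {uniq_p} => [_ /= <-|w p /andP[/and3P[]]].
  have Sp : {subset root eS u :: p <= S}.
    apply/allP; rewrite /= Sroot /=; elim: p (root eS u) pathp {eq_u uniq_p Sroot} => //=.
    by move=> w p IHp x /andP[/and3P[_ -> _] /IHp].
  have lt_p : size p < m.
    apply: leq_trans le_S; rewrite -[(size p).+1]/(size (root eS u :: p)).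
    rewrite -(card_uniqP uniq_p); apply/subset_leq_card/subsetP => x; exact: Sp.
  have pathe : path shift_edge (root eS u) p.
    by apply: sub_path pathp => x y /and3P[].
  have nth_mid : nth (mid u) (root eS u) m = mid u.
    by rewrite [RHS]/mid (tnth_nth (mid u)) inordK //; lia.
  have [j [j1 [j2 nth_j]]] := nth_shift_path pathe (ltnW lt_p) nth_mid.
  exists j; rewrite -eq_u in nth_j; move: (size p) lt_p j1 j2 => l *.
  split=> //; lia.
have arrow_case u v : u \in S -> v \in S -> arrow u v ->
    odd (index (mid u) u) != odd (index (mid v) v).
  move=> Su Sv arr_uv.
  have -> : mid v = mid u.
    rewrite /mid; congr tnth; apply/esym/(rootP symS)/connect1.
    by rewrite /eS Su Sv /shift_edge arr_uv.
  have [[|j] []] := pos_mid u Su => // _ lt_j nth_j.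
  have nth_v : nth (mid u) v j = mid u by rewrite -(nth_arrow _ arr_uv) //; lia.
  have [sorted_u sorted_v _] := and3P arr_uv.
  (* Increasing tuples have distinct entries, so [index] finds these two positions, which differ by
     one. *)
  rewrite -{1}nth_j -{2}nth_v !index_uniq ?size_tuple ?ord_lt_sorted_uniq //; lia.
move=> u v Su Sv /orP[|arr_vu]; first exact: arrow_case.
by rewrite eq_sym; apply: arrow_case.
Qed.

End ShiftGraph.

Lemma locally_bipartite_graph m k : exists (V : finType) (e : rel V),
  [/\ symmetric e,
      forall S : {set V}, #|S| <= m -> exists c : V -> bool,
        forall u v, u \in S -> v \in S -> e u v -> c u != c v
    & forall c : V -> 'I_k, exists u v, e u v /\ c u = c v].
Proof.
(* The extra colour [None] is for sequences of the wrong length. *)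
have [N hN] := shift_chromatic (2 * m) (option 'I_k).
exists ((2 * m).+1.-tuple 'I_N)%type, (@shift_edge m N); split.
- exact: shift_edge_sym.
- exact: shift_locally_bipartite.
move=> c; have [x [s [y [sz_s sorted_s eq_c]]]] := hN (fun s => omap c (insub s)).
have sz_u : size (x :: s) == (2 * m).+1 by rewrite /= sz_s.
have sz_v : size (rcons s y) == (2 * m).+1 by rewrite size_rcons sz_s.
move: eq_c; rewrite (insubT (fun t : seq 'I_N => size t == _) sz_u).
rewrite (insubT (fun t : seq 'I_N => size t == _) sz_v) => -[eq_c].
exists (Tuple sz_u), (Tuple sz_v); split=> //.
apply/orP; left; apply/and3P; split=> /=.
- by move: sorted_s; rewrite -cats1 -cat_cons => /cat_sorted2[].
- exact: path_sorted sorted_s.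
- by rewrite -sz_s -cats1 take_size_cat.
Qed.

(** * Graph semirings *)

Fixpoint cont (t : term) : seq nat :=
  match t with
  | Var i => [:: i]
  | Add t1 t2 | Mul t1 t2 => cont t1 ++ cont t2
  end.

Lemma eq_eval (A : algebra) (v w : nat -> A) t :
  (forall i, i \in cont t -> v i = w i) -> eval v t = eval w t.
Proof.
elim: t => [i|t1 IH1 t2 IH2|t1 IH1 t2 IH2] /= eq_vw; first by apply: eq_vw; rewrite inE.
all: by rewrite IH1 ?IH2 // => i ti; apply: eq_vw; rewrite mem_cat ti ?orbT.
Qed.

Lemma hom_eval (A B : algebra) (f : A -> B) (v : nat -> A) t :
  hom f -> f (eval v t) = eval (fun i => f (v i)) t.
Proof. by case=> fD fM; elim: t => //= t1 <- t2 <-; rewrite ?fD ?fM. Qed.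

(** For irreflexive [e] this decides whether [t] is nonzero on single vertices ([eval_vertexP]). *)
Fixpoint valid (V : Type) (e : rel V) (s : nat -> V) (t : term) : bool :=
  match t with
  | Var _ => true
  | Add t1 t2 => valid e s t1 && valid e s t2
  | Mul t1 t2 => [&& valid e s t1, valid e s t2 &
                     allrel (fun i j => e (s i) (s j)) (cont t1) (cont t2)]
  end.

Lemma sub_valid (V V' : Type) (e : rel V) (e' : rel V') s s' t :
  (forall i j, i \in cont t -> j \in cont t -> e (s i) (s j) -> e' (s' i) (s' j)) ->
  valid e s t -> valid e' s' t.
Proof.
elim: t => //= t1 IH1 t2 IH2 sub.
all: have {}IH1 : valid e s t1 -> valid e' s' t1
  by apply: IH1 => i j ti tj; apply: sub; rewrite mem_cat ?ti ?tj.
all: have {}IH2 : valid e s t2 -> valid e' s' t2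
  by apply: IH2 => i j ti tj; apply: sub; rewrite mem_cat ?ti ?tj orbT.
- by case/andP=> /IH1-> /IH2->.
- case/and3P=> /IH1-> /IH2-> /allrelP valid12; apply/allrelP => i j ti tj.
  by apply: sub; rewrite ?mem_cat ?ti ?tj ?orbT // valid12.
Qed.

(** Validity is a conjunction of adjacency demands that depend on [t] alone, so the demand broken by
    [s] is met by every valid map into any graph. *)
Lemma not_valid_edge (V : Type) (e : rel V) s t : ~~ valid e s t ->
  exists i j, [/\ i \in cont t, j \in cont t, ~~ e (s i) (s j) &
    forall (V' : Type) (e' : rel V') s', valid e' s' t -> e' (s' i) (s' j)].
Proof.
have lift t1 t3 :
    {subset cont t1 <= cont t3} ->
    (forall (V' : Type) (e' : rel V') s', valid e' s' t3 -> valid e' s' t1) ->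
    (exists i j, [/\ i \in cont t1, j \in cont t1, ~~ e (s i) (s j) &
      forall (V' : Type) (e' : rel V') s', valid e' s' t1 -> e' (s' i) (s' j)]) ->
    (exists i j, [/\ i \in cont t3, j \in cont t3, ~~ e (s i) (s j) &
      forall (V' : Type) (e' : rel V') s', valid e' s' t3 -> e' (s' i) (s' j)]).
  move=> subc subv [i [j [ti tj nij hij]]]; exists i, j.
  by split=> [||//|V' e' s' /subv/hij]; try apply: subc.
elim: t => //= t1 IH1 t2 IH2; rewrite ?negb_and.
- case/orP=> [/IH1|/IH2].
  + apply: (lift _ (Add t1 t2)) => [i ti|V' e' s' /andP[]//].
    by rewrite mem_cat ti.
  + apply: (lift _ (Add t1 t2)) => [i ti|V' e' s' /andP[]//].
    by rewrite mem_cat ti orbT.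
- case/or3P=> [/IH1|/IH2|].
  + apply: (lift _ (Mul t1 t2)) => [i ti|V' e' s' /and3P[]//].
    by rewrite mem_cat ti.
  + apply: (lift _ (Mul t1 t2)) => [i ti|V' e' s' /and3P[]//].
    by rewrite mem_cat ti orbT.
  case/allPn=> i ti /allPn[j tj nij]; exists i, j; rewrite !mem_cat ti tj orbT; split=> //.
  by move=> V' e' s' /and3P[_ _ /allrelP]; apply.
Qed.

Section GraphSemiring.
Variables (V : finType) (e : rel V).

Definition vset := {U : {set V} | U != set0}.

Lemma vsetU_subproof (U1 U2 : vset) : val U1 :|: val U2 != set0.
Proof. by rewrite setU_eq0 negb_and (valP U1). Qed.

Definition vsetU (U1 U2 : vset) : vset := exist _ (val U1 :|: val U2) (vsetU_subproof U1 U2).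

Definition complete (U1 U2 : vset) : bool :=
  [forall x in val U1, forall y in val U2, e x y].

Definition graph_add (x y : option vset) : option vset :=
  match x, y with
  | Some U1, Some U2 => Some (vsetU U1 U2)
  | _, _ => None
  end.

Definition graph_mul (x y : option vset) : option vset :=
  match x, y with
  | Some U1, Some U2 => if complete U1 U2 then Some (vsetU U1 U2) else None
  | _, _ => None
  end.

Definition graph_semiring : algebra := @Algebra (option vset) graph_add graph_mul.

Definition in_val (z : option vset) (x : V) : bool := if z is Some U then x \in val U else false.

Lemma completeP (U1 U2 : vset) :
  reflect (forall x y, x \in val U1 -> y \in val U2 -> e x y) (complete U1 U2).
Proof.
apply: (iffP forall_inP) => [cU x y Ux Uy|cU x Ux]; first exact: (forall_inP (cU x Ux)).
by apply/forall_inP => y; apply: cU.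
Qed.

Lemma mem_eval (v : nat -> graph_semiring) t U : eval v t = Some U ->
  forall x, (x \in val U) = has (fun i => in_val (v i) x) (cont t).
Proof.
elim: t U => [i|t1 IH1 t2 IH2|t1 IH1 t2 IH2] U /=.
- by move=> eq_v x; rewrite eq_v orbF.
- case: (eval v t1) IH1 => [U1|] //= /(_ _ erefl) IH1.
  case: (eval v t2) IH2 => [U2|] //= /(_ _ erefl) IH2 [<-] x.
  by rewrite inE has_cat IH1 IH2.
- case: (eval v t1) IH1 => [U1|] //= /(_ _ erefl) IH1.
  case: (eval v t2) IH2 => [U2|] //= /(_ _ erefl) IH2.
  by case: ifP => // _ [<-] x; rewrite inE has_cat IH1 IH2.
Qed.

Lemma eval_some_cont (v : nat -> graph_semiring) t :
  eval v t <> None -> forall i, i \in cont t -> v i <> None.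
Proof.
elim: t => [i|t1 IH1 t2 IH2|t1 IH1 t2 IH2] /=; first by move=> + j; rewrite inE => + /eqP->.
all: case: (eval v t1) IH1 => [U1|] //= IH1.
all: case: (eval v t2) IH2 => [U2|] //= IH2 _ i; rewrite mem_cat => /orP[]; [exact: IH1|exact: IH2].
Qed.

(** Factors of a nonzero product are completely joined, so any choice of one vertex per variable
    sends multiplied variables to adjacent vertices. *)
Lemma eval_some_valid (v : nat -> graph_semiring) t s :
  eval v t <> None -> (forall i, i \in cont t -> in_val (v i) (s i)) -> valid e s t.
Proof.
elim: t => [i|t1 IH1 t2 IH2|t1 IH1 t2 IH2] //= neq0 sel.
all: have sel1 i : i \in cont t1 -> in_val (v i) (s i)
  by move=> ti; apply: sel; rewrite mem_cat ti.
all: have sel2 i : i \in cont t2 -> in_val (v i) (s i)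
  by move=> ti; apply: sel; rewrite mem_cat ti orbT.
all: have mem1 := @mem_eval v t1; have mem2 := @mem_eval v t2.
all: case: (eval v t1) neq0 IH1 mem1 => [U1|] //= neq0 IH1 mem1.
all: case: (eval v t2) neq0 IH2 mem2 => [U2|] //= neq0 IH2 mem2.
all: rewrite IH1 ?IH2 //=.
case: completeP neq0 => // cU _; apply/allrelP => i j ti tj; apply: cU.
- by rewrite (mem1 _ erefl); apply/hasP; exists i; last exact: sel1.
- by rewrite (mem2 _ erefl); apply/hasP; exists j; last exact: sel2.
Qed.

Lemma exists_selection (x0 : V) (v : nat -> graph_semiring) :
  exists s, forall i, v i <> None -> in_val (v i) (s i).
Proof.
exists (fun i => if v i is Some U then odflt x0 [pick x in val U] else x0) => i.
case: (v i) => [[U U0]|] //= _; case: pickP => //= U_empty.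
by case/set0Pn: U0 => x; rewrite U_empty.
Qed.

Lemma eval_none (irr_e : irreflexive e) (x0 : V) (v : nat -> graph_semiring) t :
  (forall i, i \in cont t -> v i <> None) -> eval v t = None ->
  exists s, (forall i, v i <> None -> in_val (v i) (s i)) /\ ~~ valid e s t.
Proof.
elim: t => [i|t1 IH1 t2 IH2|t1 IH1 t2 IH2] //= def_v.
  by move=> vi; case: (def_v i); rewrite ?inE.
all: have {}IH1 := IH1 (fun i ti => def_v i (etrans (mem_cat _ _ _) (introT orP (or_introl ti)))).
all: have {}IH2 := IH2 (fun i ti => def_v i (etrans (mem_cat _ _ _) (introT orP (or_intror ti)))).
all: have mem1 := @mem_eval v t1; have mem2 := @mem_eval v t2.
all: case: (eval v t1) IH1 mem1 => [U1|] /= IH1 mem1; last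
  by have [s [sel /negbTE nval]] := IH1 erefl; exists s; rewrite nval.
all: case: (eval v t2) IH2 mem2 => [U2|] /= IH2 mem2; last
  by have [s [sel /negbTE nval]] := IH2 erefl; exists s; rewrite nval ?andbF.
- by [].
case: ifP => // /negbT ncU _.
move: ncU; rewrite negb_forall => /existsP[x]; rewrite negb_imply => /andP[Ux].
rewrite negb_forall => /existsP[y]; rewrite negb_imply => /andP[Uy nexy].
move: Ux; rewrite (mem1 _ erefl) => /hasP[i ti vix].
move: Uy; rewrite (mem2 _ erefl) => /hasP[j tj vjy].
have [s sel] := exists_selection x0 v.
(* If [i] and [j] are the same variable, it goes to [x], and irreflexivity forbids the edge. *)
exists (fun l => if l == i then x else if l == j then y else s l); split.
  move=> l vl; case: eqP => [->|_] //; case: eqP => [->|_] //; exact: sel.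
apply/negP => /and3P[_ _ /allrelP/(_ i j ti tj)]; rewrite eqxx.
case: eqP => [_|_]; first by rewrite irr_e.
by rewrite eqxx (negbTE nexy).
Qed.

Lemma set1_neq0 (x : V) : [set x] != set0.
Proof. by apply/set0Pn; exists x; rewrite inE. Qed.

Definition vertex (x : V) : graph_semiring :=
  Some (exist (fun U : {set V} => U != set0) [set x] (set1_neq0 x)).

Lemma eval_vertexP (irr_e : irreflexive e) (s : nat -> V) t :
  eval (fun i => vertex (s i)) t <> None <-> valid e s t.
Proof.
split=> [neq0|val_s eq0].
  by apply: eval_some_valid neq0 _ => i _ /=; rewrite inE.
have [//|s' [sel /negP[]]] := eval_none irr_e (s 0) _ eq0.
have eq_s i : s' i = s i by have /set1P : in_val (vertex (s i)) (s' i) by apply: sel.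
by apply: sub_valid val_s => i j _ _; rewrite !eq_s.
Qed.

End GraphSemiring.

(** * Transfer of short identities from K_k to locally colourable graphs *)

Definition locally_colorable (V : finType) (e : rel V) m k : Prop :=
  forall (S : {set V}) a b, #|S| <= m -> ~~ e a b ->
    exists c : V -> 'I_k, c a = c b /\
      forall x y, x \in S -> y \in S -> e x y -> c x != c y.

Definition neq_rel k : rel 'I_k := fun i j => i != j.

Lemma irr_neq k : irreflexive (@neq_rel k).
Proof. by move=> i; rewrite /neq_rel eqxx. Qed.

Section Transfer.
Variables (V : finType) (e : rel V) (m k : nat).
Hypotheses (irr_e : irreflexive e) (loc_e : locally_colorable e m k).

(** If [q] were 0, some choice of vertices would send two variables multiplied in [q] to nonadjacent
    vertices. A colouring that merges these two but is proper on the image of [p] keeps [p] nonzero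
    over K_k and makes [q] zero there. Once [q] is nonzero, equal contents give equal values. *)
Lemma eval_some_transfer (p q : term) (v : nat -> graph_semiring e) U :
  size (cont p) <= m -> satisfies (graph_semiring (@neq_rel k)) (p, q) ->
  eval v p = Some U -> eval v q = Some U.
Proof.
move=> le_p sat_pq eq_p.
have def_p : eval v p <> None by rewrite eq_p.
have [x0 _] := set0Pn _ (valP U).
have colors s a b : ~~ e a b -> valid e s p ->
    exists c : V -> 'I_k, c a = c b /\ valid (@neq_rel k) (c \o s) p.
  move=> nab val_s.
  have [|c [cab col_c]] := loc_e (S := [set x in map s (cont p)]) _ nab.
    by rewrite cardsE (leq_trans (card_size _)) ?size_map.
  exists c; split=> //; apply: sub_valid val_s => i j ti tj.
  by apply: col_c; rewrite inE map_f.
have [d sel_d] := exists_selection x0 v.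
have val_d : valid e d p.
  by apply: (eval_some_valid def_p) => i pi; apply/sel_d/(eval_some_cont def_p).
(* Only a colouring is wanted here, so the pair to merge is a trivial one. *)
have [c [_ val_c]] := colors d x0 x0 (negbT (irr_e x0)) val_d.
have cont_sub p' q' : eval (fun i => vertex (@neq_rel k) (c (d i))) p' <> None ->
    satisfies (graph_semiring (@neq_rel k)) (p', q') -> {subset cont q' <= cont p'}.
  move=> def' sat' j q'j; apply: contraT => p'j.
  (* A variable of [q'] missing from [p'] could be sent to 0, which would kill [q'] alone. *)
  pose w (i : nat) : graph_semiring (@neq_rel k) := if i == j then None else vertex (@neq_rel k) (c (d i)).
  have eq_w : eval w p' = eval (fun i => vertex (@neq_rel k) (c (d i))) p'.
    by apply: eq_eval => i p'i; rewrite /w; case: eqP => // eq_ij; rewrite -eq_ij p'i in p'j.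
  have def_q' : eval w q' <> None by rewrite -[eval w q'](sat' w) /= eq_w.
  by have := eval_some_cont def_q' q'j; rewrite /w eqxx.
have def_cp := (eval_vertexP (@irr_neq k) (c \o d) p).2 val_c.
have eq_cont : cont p =i cont q.
  move=> i; apply/idP/idP; last exact: cont_sub def_cp sat_pq i.
  apply: (cont_sub q p) => [|w]; last by rewrite (sat_pq w).
  by rewrite -[eval _ q](sat_pq _).
case eq_q: (eval v q) => [U'|].
  congr Some; apply/val_inj/setP => x.
  by rewrite (mem_eval eq_q) (mem_eval eq_p); apply/esym/eq_has_r.
have [|s [sel nval]] := eval_none irr_e x0 _ eq_q.
  by move=> i; rewrite -eq_cont; apply: eval_some_cont.
have val_s : valid e s p.
  by apply: (eval_some_valid def_p) => i pi; apply/sel/(eval_some_cont def_p).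
have [i [j [_ _ nij edge_ij]]] := not_valid_edge nval.
have [c' [cij /(eval_vertexP (@irr_neq k)) val_c']] := colors s _ _ nij val_s.
have : valid (@neq_rel k) (c' \o s) q.
  by apply/(eval_vertexP (@irr_neq k)); rewrite -[eval _ q](sat_pq _).
by move/edge_ij; rewrite /neq_rel /= cij eqxx.
Qed.

Lemma satisfies_transfer (p q : term) :
  size (cont p) <= m -> size (cont q) <= m ->
  satisfies (graph_semiring (@neq_rel k)) (p, q) -> satisfies (graph_semiring e) (p, q).
Proof.
move=> le_p le_q sat_pq v /=.
case eq_p: (eval v p) => [U|]; first by rewrite (eval_some_transfer le_p sat_pq eq_p).
case eq_q: (eval v q) => [U|] //.
by rewrite -eq_p; apply: (eval_some_transfer le_q) eq_q => w; rewrite (sat_pq w).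
Qed.

End Transfer.

(** Two vertex sets of K_k are completely joined exactly when they are disjoint. The carriers are
    convertible, so evaluations in both can be equated. *)
Lemma Sc_word_graph k (e : identity) :
  satisfies (Sc_word k) e <-> satisfies (graph_semiring (@neq_rel k)) e.
Proof.
have eq_ev (v : nat -> option (sqfree_word k)) t :
    eval (A := Sc_word k) v t = eval (A := graph_semiring (@neq_rel k)) v t.
  have eqU (U1 U2 : sqfree_word k) : wordU U1 U2 = vsetU U1 U2 by apply: val_inj.
  elim: t => //= t1 -> t2 ->.
    by case: (eval _ t1) => // U1; case: (eval _ t2) => // U2 /=; rewrite eqU.
  case: (eval _ t1) => // U1; case: (eval _ t2) => // U2 /=; rewrite eqU.
  suff -> : [disjoint val U1 & val U2] = complete (@neq_rel k) U1 U2 by [].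
  apply/idP/completeP => [dU x y Ux Uy|cU].
    by apply/eqP => eq_xy; move/disjointFr: dU => /(_ _ Ux); rewrite eq_xy Uy.
  apply/pred0P => x /=; apply/negP => /andP[Ux Uy].
  by have := cU _ _ Ux Uy; rewrite /neq_rel eqxx.
by split=> sat v; have := sat v; rewrite !eq_ev.
Qed.

(** * The separating identity *)

Definition sum_edge (V : Type) (e : rel V) k : rel (V + 'I_k) := fun a b =>
  match a, b with
  | inl x, inl y => e x y
  | inr i, inr j => i != j
  | _, _ => false
  end.

(** Both [a] and [b] get a colour [j], the other clique vertices keep their own, and the rest of the
    bipartite part uses two colours distinct from [j]. *)
Lemma sum_locally_colorable (V : finType) (e : rel V) m k : 2 < k -> symmetric e ->
  irreflexive e ->
  (forall S : {set V}, #|S| <= m -> exists c : V -> bool,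
     forall x y, x \in S -> y \in S -> e x y -> c x != c y) ->
  locally_colorable (@sum_edge V e k) m k.
Proof.
move=> k_gt2 sym_e irr_e bip_e S a b le_S nab.
have [|c col_c] := bip_e [set x | inl x \in S].
  rewrite -(card_imset _ (@inl_inj V 'I_k)); apply: leq_trans le_S.
  by apply/subset_leq_card/subsetP => _ /imsetP[x + ->]; rewrite inE.
pose i0 : 'I_k := Ordinal (ltnW (ltnW k_gt2)).
(* A clique vertex among [a] and [b] keeps its colour; if both are clique vertices, they are equal,
   being nonadjacent. *)
pose j := match a, b with inr i, _ => i | _, inr i => i | _, _ => i0 end.
have /card_gt1P[c0 [c1 [c0j c1j c01]]] : 1 < #|[set~ j]|.
  by rewrite cardsC1 card_ord; lia.
move: c0j c1j; rewrite !inE => c0j c1j.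
pose col x := if (x == a) || (x == b) then j else
  match x with inl x => if c x then c0 else c1 | inr i => i end.
exists col; split; first by rewrite /col !eqxx orbT.
have sym_s : symmetric (@sum_edge V e k).
  by move=> [x|i] [y|l] //=; rewrite eq_sym.
have irr_s : irreflexive (@sum_edge V e k) by case=> [x|i] /=; rewrite ?irr_e ?eqxx.
have col_special x y : (x == a) || (x == b) -> ~~ ((y == a) || (y == b)) ->
    sum_edge e x y -> col x != col y.
  rewrite /col => spec_x; rewrite spec_x; case: ifP => // nspec _.
  case: y nspec => [y|l] nspec exy; first by case: (c y); rewrite eq_sym.
  move: nspec => /norP[la lb]; rewrite /j.
  case: x exy spec_x => [//|i] /= il /orP[]/eqP ei; first by rewrite -ei.
  by move: la; case: (a) => [x|i'] la; rewrite -?ei //= eq_sym.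
move=> x y Sx Sy exy.
case spec_x: ((x == a) || (x == b)); case spec_y: ((y == a) || (y == b)).
- by move: spec_x spec_y exy => /orP[]/eqP-> /orP[]/eqP->;
    rewrite ?irr_s // ?(negbTE nab) // sym_s (negbTE nab).
- by apply: col_special; rewrite ?spec_y.
- by rewrite eq_sym; apply: col_special; rewrite ?spec_x 1?sym_s.
rewrite /col spec_x spec_y; case: x y exy Sx Sy {spec_x spec_y} => [x|i] [y|l] //= exy Sx Sy.
have: c x != c y by apply: col_c => //; rewrite inE.
by case: (c x); case: (c y) => //=; rewrite eq_sym.
Qed.

Definition clique_term (z : nat) (zs : seq nat) : term :=
  foldr (fun i t => Mul (Var i) t) (Var z) zs.

(** The fold starts from a term because the signature has no constant for an empty sum. *)
Definition graph_term (es : seq (nat * nat)) (t : term) : term :=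
  foldr (fun p u => Add (Mul (Var p.1) (Var p.2)) u) t es.

Lemma cont_clique_term z zs : cont (clique_term z zs) =i z :: zs.
Proof.
by elim: zs => //= y zs IHzs i; rewrite inE IHzs !inE orbCA.
Qed.

Lemma valid_clique_term (V : Type) (e : rel V) s z zs :
  uniq (z :: zs) ->
  (forall i j, i \in z :: zs -> j \in z :: zs -> i != j -> e (s i) (s j)) ->
  valid e s (clique_term z zs).
Proof.
elim: zs => //= y zs IHzs; rewrite inE negb_or.
case/andP=> /andP[neq_zy z_zs] /andP[y_zs uniq_zs] es.
have sub i : i \in z :: zs -> i \in [:: z, y & zs].
  by rewrite !inE => /orP[]->; rewrite ?orbT.
rewrite IHzs /=; last 2 first.
- by rewrite z_zs.
- by move=> i j /sub iz /sub jz; apply: es.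
rewrite allrel1l; apply/allP => i; rewrite cont_clique_term => iz.
apply: es; [by rewrite !inE eqxx orbT|exact: sub|].
by apply/eqP => eq_yi; move: iz; rewrite -eq_yi inE eq_sym (negbTE neq_zy) (negbTE y_zs).
Qed.

Lemma valid_graph_term (V : Type) (e : rel V) s es t :
  valid e s (graph_term es t) =
    all (fun p => e (s p.1) (s p.2)) es && valid e s t.
Proof. by elim: es => //= p es ->; rewrite andbA /= allrel1l /= andbT. Qed.

(** The added square demands a loop at the vertex of [z]. *)
Definition clique_loop (es : seq (nat * nat)) z zs : identity :=
  let t := graph_term es (clique_term z zs) in (t, Add t (Mul (Var z) (Var z))).

Lemma Sc_pow_clique_loop n k es z zs :
  n <= 2 * k - 2 -> k <= (size zs).+1 -> satisfies (Sc_pow n) (clique_loop es z zs).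
Proof.
move=> le_n le_k v /=.
(* Indices are exponents minus one, so a product has one more than the sum of the indices. *)
have pow_mulP (x y : option 'I_n) (l : 'I_n) : pow_mul x y = Some l ->
    exists i j : 'I_n, [/\ x = Some i, y = Some j & val l = (i + j).+1].
  case: x y => [i|] [j|] //=; case: insubP => // l' _ eq_l' [<-].
  by exists i, j.
have clique (i : 'I_n) : eval (A := Sc_pow n) v (clique_term z zs) = Some i ->
    exists j : 'I_n, v z = Some j /\ j + size zs <= i.
  elim: zs i {le_k} => [|y zs IHzs] i /=; first by exists i; rewrite addn0.
  case/pow_mulP => [a [b [_ /IHzs[j [vz le_j]] eq_i]]].
  by exists j; split=> //; move: eq_i => /= ->; lia.
have graph (i : 'I_n) : eval (A := Sc_pow n) v (graph_term es (clique_term z zs)) = Some i ->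
    exists j : 'I_n, v z = Some j /\ j + size zs <= i.
  elim: es i => //= p es IHes i.
  case: (pow_mul _ _) => [l|] //=.
  case: (eval _ _) IHes => [l'|] //= /(_ _ erefl)[j [vz le_j]] [<-].
  by exists j; split=> //; case: ifP => // /negbT; lia.
case eq_t: (eval _ _) => [i|] //.
have [j [-> le_j]] := graph i eq_t.
have lt_i := ltn_ord i.
(* Since k - 1 <= [size zs], 2j + 1 <= 2i + 1 - (2k - 2) <= 2i + 1 - n <= i, so the square of [z] is
   nonzero and absorbed. *)
rewrite /= insubT => [|lt]; first lia.
congr Some; case: ifP => //= le; apply: val_inj => /=; lia.
Qed.

Lemma graph_semiring_clique_loop (V : finType) (e : rel V) (irr_e : irreflexive e) es z zs :
  (forall s, ~~ valid e s (graph_term es (clique_term z zs))) ->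
  satisfies (graph_semiring e) (clique_loop es z zs).
Proof.
move=> nval v /=; case eq_t: (eval v _) => [U|] //.
have [x0 _] := set0Pn _ (valP U).
have [s sel] := exists_selection x0 v.
have def_t : eval v (graph_term es (clique_term z zs)) <> None by rewrite eq_t.
case/negP: (nval s); apply: (eval_some_valid def_t) => i ti.
exact/sel/(eval_some_cont def_t).
Qed.

(** * Varieties defined by one identity *)

Definition models (e : identity) : algebra -> Prop :=
  fun A => ai_semiring A /\ satisfies A e.

(** Generated varieties and joins are intersections of varieties, so this lets an identity of the
    join be checked on the generators. *)
Lemma models_variety e : variety (models e).
Proof.
split=> [A []//|A B f [fD fM] f_surj [[iA AA AC AI MA MDl MDr] sat_e]
  |A B f iA [fD fM] f_inj [[_ AA AC AI MA MDl MDr] sat_e]|I F modF].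
(* Choice gives a section of [f], through which elements and valuations are lifted. *)
- pose g y := proj1_sig (constructive_indefinite_description _ (f_surj y)).
  have fK y : f (g y) = y by rewrite /g; case: constructive_indefinite_description.
  split.
    split.
    + by case: iA => x; constructor; exact: f x.
    + by move=> x y z; rewrite -(fK x) -(fK y) -(fK z) -!fD AA.
    + by move=> x y; rewrite -(fK x) -(fK y) -!fD AC.
    + by move=> x; rewrite -(fK x) -!fD AI.
    + by move=> x y z; rewrite -(fK x) -(fK y) -(fK z) -!fM MA.
    + by move=> x y z; rewrite -(fK x) -(fK y) -(fK z) -!(fD, fM) MDl.
    + by move=> x y z; rewrite -(fK x) -(fK y) -(fK z) -!(fD, fM) MDr.
  move=> v; pose w i := g (v i).
  have eq_v t : eval v t = f (eval w t).
    by rewrite (hom_eval _ _ (conj fD fM)); apply: eq_eval => i _; rewrite fK.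
  by rewrite !eq_v sat_e.
- split.
    split=> //.
    + by move=> x y z; apply: f_inj; rewrite !fD AA.
    + by move=> x y; apply: f_inj; rewrite !fD AC.
    + by move=> x; apply: f_inj; rewrite !fD AI.
    + by move=> x y z; apply: f_inj; rewrite !fM MA.
    + by move=> x y z; apply: f_inj; rewrite !(fD, fM) MDl.
    + by move=> x y z; apply: f_inj; rewrite !(fD, fM) MDr.
  by move=> v; apply: f_inj; rewrite !(hom_eval _ _ (conj fD fM)) sat_e.
split.
  split.
  - constructor=> i; have [[iF _ _ _ _ _ _] _] := modF i.
    exact: epsilon iF (fun=> True).
  - move=> x y z; apply: functional_extensionality_dep => i.
    by have [[_ H _ _ _ _ _] _] := modF i; apply: H.
  - move=> x y; apply: functional_extensionality_dep => i.
    by have [[_ _ H _ _ _ _] _] := modF i; apply: H.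
  - move=> x; apply: functional_extensionality_dep => i.
    by have [[_ _ _ H _ _ _] _] := modF i; apply: H.
  - move=> x y z; apply: functional_extensionality_dep => i.
    by have [[_ _ _ _ H _ _] _] := modF i; apply: H.
  - move=> x y z; apply: functional_extensionality_dep => i.
    by have [[_ _ _ _ _ H _] _] := modF i; apply: H.
  - move=> x y z; apply: functional_extensionality_dep => i.
    by have [[_ _ _ _ _ _ H] _] := modF i; apply: H.
move=> v; apply: functional_extensionality_dep => i.
have hom_i : @hom (product F) (F i) (fun x => x i) by [].
have eq_v t : eval v t i = eval (fun j => v j i) t := hom_eval v t hom_i.
by rewrite !eq_v (modF i).2.
Qed.

Theorem theorem10p2 (k n : nat) (hk : 3 <= k) (hn1 : 1 <= n) (hn : n <= 2 * k - 2)
    (W : algebra -> Prop)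
    (hW : var_interval (var_gen (Sc_word k))
            (var_join (var_gen (Sc_pow n)) (var_gen (Sc_word k))) W) :
  ~ finitely_based W.
Proof.
case: hW => _ sub_wordW sub_Wjoin [r [s [sat_s basis_s]]].
(* The number of variable occurrences in the whole basis bounds that in each of its sides. *)
pose m := \sum_i (size (cont (s i).1) + size (cont (s i).2)).
(* With [m.+1], one-vertex sets are 2-coloured even if [m = 0], which excludes loops. *)
have [V [e [sym_e bip_e chi_e]]] := locally_bipartite_graph m.+1 k.
have irr_e : irreflexive e.
  move=> x; apply/negP => exx; have [|c] := bip_e [set x]; first by rewrite cards1.
  by move/(_ x x); rewrite inE eqxx => /(_ isT isT exx); rewrite eqxx.
pose e' := @sum_edge V e k.
have irr_e' : irreflexive e' by case=> [x|i] /=; rewrite ?irr_e ?eqxx.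
have loc_e' : locally_colorable e' m k.
  by apply: sum_locally_colorable => // S le_S; apply: bip_e; apply: leqW.
pose z0 : 'I_k := Ordinal (ltnW (ltnW hk)).
pose z : V + 'I_k := inr z0.
pose zs : seq (V + 'I_k) := [seq inr i | i <- enum (predC1 z0)].
(* Variables are the codes of vertices. *)
pose es : seq (nat * nat) :=
  [seq (pickle (inl p.1 : V + 'I_k), pickle (inl p.2 : V + 'I_k)) | p <- enum [pred p | e p.1 p.2]].
pose loop := clique_loop es (pickle z) (map pickle zs).
have word_loop : satisfies (Sc_word k) loop.
  apply/Sc_word_graph/graph_semiring_clique_loop => [|f]; first exact: irr_neq.
  (* A valid map would be a proper [k]-colouring of the shift graph. *)
  apply/negP; rewrite valid_graph_term => /andP[/allP col_f _].
  have [x [y [exy eq_f]]] := chi_e (fun x => f (pickle (inl x : V + 'I_k))).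
  have := col_f (pickle (inl x : V + 'I_k), pickle (inl y : V + 'I_k)).
  rewrite /neq_rel /= eq_f eqxx => /(_ _)/negP[] //.
  by apply/mapP; exists (x, y); rewrite // mem_enum.
have pow_loop : satisfies (Sc_pow n) loop.
  apply: Sc_pow_clique_loop hn _.
  by rewrite !size_map -cardE cardC1 card_ord; lia.
have W_loop : identity_of W loop.
  move=> A WA; suff [] : models loop A by []; apply: (sub_Wjoin A WA).
  - exact: models_variety.
  - by move=> B; apply; [exact: models_variety|split; first exact: Sc_pow_ai].
  - by move=> B; apply; [exact: models_variety|split; first exact: Sc_word_ai].
(* The basis holds over K_k and is short, so it carries over to [e'], and with it its consequence
   [loop]. *)
have: satisfies (graph_semiring e') loop.
  apply: (basis_s _ W_loop) => i.
  have le_m : size (cont (s i).1) + size (cont (s i).2) <= m.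
    by rewrite /m (bigD1 i) //= leq_addr.
  rewrite [s i]surjective_pairing; apply: (satisfies_transfer irr_e' loc_e').
  - by apply: leq_trans le_m; apply: leq_addr.
  - by apply: leq_trans le_m; apply: leq_addl.
  rewrite -surjective_pairing -Sc_word_graph; apply: sat_s.
  by apply: sub_wordW => W'.
(* Each variable goes to the vertex it codes, and numbers that code none to [z]. This makes the left
   side nonzero and the right side 0. *)
pose dec i : V + 'I_k := odflt z (unpickle i).
have decK x : dec (pickle x) = x by rewrite /dec pickleK.
move/(_ (fun i => vertex e' (dec i))).
set t := loop.1; have val_t : valid e' dec t.
  rewrite valid_graph_term; apply/andP; split.
    by apply/allP => _ /mapP[[x y] + ->]; rewrite mem_enum !decK.
  apply: valid_clique_term; rewrite -map_cons.
    rewrite (map_inj_uniq (pcan_inj pickleK)) /= (map_inj_uniq inr_inj) enum_uniq andbT.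
    by apply/mapP => -[i + [eq_i]]; rewrite mem_enum -eq_i inE eqxx.
  have inrP a : a \in z :: zs -> exists i, a = inr i.
    by rewrite inE => /predU1P[->|/mapP[i _ ->]]; [exists z0|exists i].
  move=> _ _ /mapP[a /inrP[i ->] ->] /mapP[b /inrP[l ->] ->] neq_il.
  by rewrite !decK /=; apply: contraNneq neq_il => ->.
have def_t := (eval_vertexP irr_e' dec t).2 val_t.
move=> eq_t; have /(eval_vertexP irr_e') : eval (fun i => vertex e' (dec i)) loop.2 <> None.
  by rewrite -eq_t.
case/andP=> _ /and3P[_ _ /allrelP/(_ (pickle z) (pickle z))].
by rewrite !inE decK irr_e' => /(_ (eqxx _) (eqxx _)).
Qed.
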